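(* Let $g_2,g_3$ be constants and $$\mathcal F(x_1,x_2,s)=(x_1-x_2)^2s^2+\Big(-2x_1x_2(x_1+x_2)+\tfrac{g_2}{2}(x_1+x_2)+g_3\Big)s+x_1^2x_2^2+x_1x_2\tfrac{g_2}{2}+g_3(x_1+x_2)+\tfrac{g_2^2}{16}.$$ Then there exist polynomials $\alpha(x_1,x_2,s)$, $\beta(x_1,x_2,s)$, $P(s)$ such that the identity $$\mathcal F(x_1,x_2,s)=\alpha^2(x_1,x_2,s)+P(s)\beta(x_1,x_2,s)$$ is satisfied. The polynomials are given by $$\alpha(x_1,x_2,s)=2s^2+s(x_1+x_2)-x_1x_2-\tfrac{g_2}{4},\quad \beta(x_1,x_2,s)=-2(x_1+x_2+s),\quad P(s)=2s^3-\tfrac{g_2}{2}s-\tfrac{g_3}{2}.$$ *)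

(* Defs.v *)
From mathcomp Require Import all_boot all_order all_algebra.
From mathcomp Require Import mpoly.

Set Implicit Arguments.
Unset Strict Implicit.
Unset Printing Implicit Defensive.

Import GRing.Theory.
Local Open Scope ring_scope.

Section Kowalevski.

Variable K : fieldType.

Local Notation R3 := {mpoly K[3]}.

Definition x1 : R3 := 'X_(inord 0).
Definition x2 : R3 := 'X_(inord 1).
Definition s : R3 := 'X_(inord 2).

(* The image in K[x1, x2, s] of a univariate polynomial in s. *)
Definition in_s (p : {poly K}) : R3 := (map_poly (@mpolyC 3 K) p).[s].

Variables g2 g3 : K.

Definition calF : R3 :=
  (x1 - x2) ^+ 2 * s ^+ 2
  + (- (2%:R * x1 * x2 * (x1 + x2)) + (g2 / 2%:R)%:MP * (x1 + x2) + g3%:MP) * s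
  + x1 ^+ 2 * x2 ^+ 2 + x1 * x2 * (g2 / 2%:R)%:MP + g3%:MP * (x1 + x2)
  + (g2 ^+ 2 / 16%:R)%:MP.

End Kowalevski.

Arguments x1 {K}.
Arguments x2 {K}.
Arguments s {K}.

(* Main.v *)
Require Import Defs.
From mathcomp Require Import all_boot all_order all_algebra.
From mathcomp Require Import mpoly.
From mathcomp Require Import ring.

Set Implicit Arguments.
Unset Strict Implicit.
Unset Printing Implicit Defensive.

Import GRing.Theory.
Local Open Scope ring_scope.

(** All three polynomials are explicit, so the claim is an identity checked by expansion.
    [in_s_cubic] turns the univariate [P] into an expression in the variable [s] of [{mpoly K[3]}];
    the denominators are powers of 2, invertible by [two_neq0]. *)

Lemma in_s_cubic (K : fieldType) (a b c : K) :
  in_s (a *: 'X^3 - b *: 'X - c%:P) = a%:MP * s ^+ 3 - b%:MP * s - c%:MP.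
Proof.
rewrite /in_s !rmorphB /= !map_polyZ /= map_polyXn map_polyX map_polyC /=.
by rewrite !hornerE.
Qed.

Theorem proposition2 (K : fieldType) (two_neq0 : 2%:R != 0 :> K) (g2 g3 : K) :
  exists (alpha beta : {mpoly K[3]}) (P : {poly K}),
    calF g2 g3 = alpha ^+ 2 + in_s P * beta /\
    alpha = 2%:R * s ^+ 2 + s * (x1 + x2) - x1 * x2 - (g2 / 4%:R)%:MP /\
    beta = - (2%:R * (x1 + x2 + s)) /\
    P = 2%:R *: 'X^3 - (g2 / 2%:R) *: 'X - (g3 / 2%:R)%:P.
Proof.
(* The witnesses are read off by unification from the three defining equations; only the identity
   remains. *)
do 3 eexists; split; last by split; [|split]; reflexivity.
rewrite in_s_cubic /calF.
(* Writing g2 = 4 a and g3 = 2 b clears the denominators, so that the identity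
   holds in any commutative ring. *)
have four_neq0 : 4%:R != 0 :> K by rewrite (natrM K 2 2) mulf_neq0.
have [a ->] : exists a, g2 = 4%:R * a by exists (g2 / 4%:R); rewrite mulrC divfK.
have [b ->] : exists b, g3 = 2%:R * b by exists (g3 / 2%:R); rewrite mulrC divfK.
have -> : 4%:R * a / 4%:R = a by rewrite mulrAC divff ?mul1r.
have -> : 4%:R * a / 2%:R = 2%:R * a by field.
have -> : 2%:R * b / 2%:R = b by field.
have -> : (4%:R * a) ^+ 2 / 16%:R = a ^+ 2.
  by rewrite (natrM K 4 4) exprMn -expr2 mulrAC divff ?mul1r // expf_neq0.
(* Pushing [%:MP] inwards leaves the constants [a%:MP] and [b%:MP] as atoms with integer
   coefficients. *)
rewrite rmorphXn !rmorphM /= !rmorph_nat.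
ring.
Qed.
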